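(* If $n\ge7$, then every root of $\chi_n$ is simple. Thus the irreducible factorization of $\chi_n$ is $$\chi_n(x)=(x-1)\,\psi_n(x)\prod_{k\in K_n}\Phi_k(x),$$ where $\Phi_k$ is the $k$-th cyclotomic polynomial and $K_n\subset\{2,3,5,8,12,18,30\}$ is the set determined by: $2\in K_n$ iff $2\mid n$; $3\in K_n$ iff $3\mid n$; $5\in K_n$ iff $n\equiv1\bmod5$; $8\in K_n$ iff $n\equiv2\bmod 8$; $12\in K_n$ iff $n\equiv3\bmod12$; $18\in K_n$ iff $n\equiv4\bmod18$; $30\in K_n$ iff $n\equiv5\bmod30$. In particular, since each of these factors can occur only once, $n-26\le\deg(\psi_n)\le n+3$.
   Context: For an integer $n\ge0$, $\chi_n(x)=-1+x^2+x^3-x^{1+n}-x^{2+n}+x^{4+n}$. For $n\ge7$, $\chi_n$ has a root $\lambda_n>1$ which is its unique root of modulus greater than one; $\psi_n$ denotes the minimal polynomial of $\lambda_n$ over $\mathbf Q$. *)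

(* Defs.v *)
From mathcomp Require Import all_boot all_order all_algebra all_field.

Set Implicit Arguments.
Unset Strict Implicit.
Unset Printing Implicit Defensive.

Import Order.TTheory GRing.Theory Num.Theory.
Local Open Scope ring_scope.

Definition chi (R : nzRingType) (n : nat) : {poly R} :=
  - 1 + 'X^2 + 'X^3 - 'X^(1 + n) - 'X^(2 + n) + 'X^(4 + n).

(* [1 < lam] in algC entails that lam is real. *)
Definition is_lambda (n : nat) (lam : algC) : Prop :=
  [/\ root (chi algC n) lam, 1 < lam
    & forall z : algC, root (chi algC n) z -> 1 < `|z| -> z = lam].

(* [minCpoly] has type {poly algC}; this is the same polynomial in {poly rat}. *)
Definition minQpoly (x : algC) : {poly rat} := s2val (minCpolyP x).

Lemma minQpolyE (x : algC) : map_poly ratr (minQpoly x) = minCpoly x.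
Proof. by case: (s2valP (minCpolyP x)) => /esym. Qed.

Definition PhiQ (k : nat) : {poly rat} := map_poly intr 'Phi_k.

Definition K (n : nat) : seq nat :=
  [seq p.1 | p <- [:: (2, 2 %| n);
                      (3, 3 %| n);
                      (5, n == 1 %[mod 5]);
                      (8, n == 2 %[mod 8]);
                      (12, n == 3 %[mod 12]);
                      (18, n == 4 %[mod 18]);
                      (30, n == 5 %[mod 30])]%N & p.2].

(* Main.v *)
(** Write chi_n = x^N P - Q with N = n + 1, P = x^3 - x - 1 and Q = x^3 P(1/x)
    = 1 - x^2 - x^3.

    Simple roots.  With S = 1 + x + x^2,
    Q(x)Q(w) - P(x)P(w) = (1 - xw)(1 + x^2 w^2 - S(x)S(w)),
    so for roots x, w with xw <> 1 the rank-one kernel S(x)S(w) equals the Gram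
    kernel 1 + x^2 w^2 + P(x)P(w) sum_(j < N) (xw)^j.  At a double root a with
    |a| <> 1, taking w near the conjugate of a and differentiating in both
    variables yields the equality case of Cauchy-Schwarz, which forces the
    derivative of (1, x^2, ...) at a to be proportional to its value:
    impossible.  If |a| = 1, a double root satisfies a cubic equation in
    t = a + 1/a with no solution in [-2, 2] when n >= 7.

    Cyclotomic part.  A root not conjugate to lambda has all its conjugates in
    the closed unit disc, so it is a root of unity z (Kronecker), say of order
    k.  Following Beukers and Smyth, z is conjugate to z^2, -z^2 or -z according
    as k is odd, 2 mod 4 or 0 mod 4.  Eliminating z^N between the equations at
    z and at this conjugate leaves a polynomial in z whose only factors besides
    x are Phi_k for k in {1, 2, 3, 5, 8, 12, 18, 30}.  For such k, P(z) <> 0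
    and z is a root of chi_j for a known j, so chi_n(z) = 0 iff z^n = z^j. *)

Require Import Defs.
From mathcomp Require Import all_boot all_order all_algebra all_field.
From mathcomp Require Import ring zify.

Set Implicit Arguments.
Unset Strict Implicit.
Unset Printing Implicit Defensive.

Import Order.TTheory GRing.Theory Num.Theory.
Local Open Scope ring_scope.

(** * Evaluation, degree and leading coefficient of chi_n *)

Lemma horner_chi (R : comNzRingType) n (x : R) :
  (chi R n).[x] = x ^+ n.+1 * (x ^+ 3 - x - 1) - (1 - x ^+ 2 - x ^+ 3).
Proof. rewrite /chi !hornerE !exprD; ring. Qed.

Lemma root_chi n (x : algC) :
  root (chi algC n) x -> x ^+ n.+1 * (x ^+ 3 - x - 1) = 1 - x ^+ 2 - x ^+ 3.
Proof. by move/rootP; rewrite horner_chi => /subr0_eq. Qed.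

Lemma map_chi (R S : nzRingType) (f : {rmorphism R -> S}) n :
  map_poly f (chi R n) = chi S n.
Proof. by rewrite /chi !(rmorphD, rmorphB, rmorphN, rmorph1) /= !map_polyXn. Qed.

Lemma size_chi_low (R : nzRingType) n :
  (size (- 1 + 'X^2 + 'X^3 - 'X^(1 + n) - 'X^(2 + n) : {poly R})%R <= n + 4)%N.
Proof.
have sizeD (p q : {poly R}) :
    (size p <= n + 4 -> size q <= n + 4 -> size (p + q)%R <= n + 4)%N.
  by move=> sp sq; apply: leq_trans (size_polyD _ _) _; rewrite geq_max sp sq.
by rewrite !sizeD ?size_polyN ?size_polyXn ?size_poly1 //; lia.
Qed.

Lemma size_chi (R : nzRingType) n : size (chi R n) = (n + 5)%N.
Proof.
rewrite /chi addrC size_polyDl ?size_polyXn; first by lia.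
apply: leq_ltn_trans (size_chi_low _ _) _; lia.
Qed.

Lemma chi_monic (R : nzRingType) n : chi R n \is monic.
Proof.
rewrite monicE /chi addrC lead_coefDl ?lead_coefXn // size_polyXn.
apply: leq_ltn_trans (size_chi_low _ _) _; lia.
Qed.

Lemma chi_neq0 (R : nzRingType) n : chi R n != 0.
Proof. exact: monic_neq0 (chi_monic R n). Qed.

Lemma root_chi_neq0 n (x : algC) : root (chi algC n) x -> x != 0.
Proof.
apply: contraTneq => ->; apply/rootP => /eqP.
rewrite horner_chi; apply/negP.
by rewrite exprS !mul0r !expr0n /= !subr0 sub0r oppr_eq0 oner_eq0.
Qed.

(** * Double roots lie on the unit circle *)

Lemma poly_ext (F : closedFieldType) (p q : {poly F}) :
  (forall x, p.[x] = q.[x]) -> p = q.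
Proof.
move=> eq_pq; apply/eqP; rewrite -subr_eq0; apply/negPn/negP => /closed_nonrootP[x].
by rewrite rootE hornerD hornerN eq_pq subrr eqxx.
Qed.

(* Equality case of Cauchy-Schwarz. *)
Lemma gram_rank1 (I : eqType) (r : seq I) (u v : I -> algC) (s t : algC) :
    \sum_(i <- r) u i * (u i)^* = s * s^* ->
    \sum_(i <- r) v i * (u i)^* = t * s^* ->
    \sum_(i <- r) v i * (v i)^* = t * t^* ->
  forall i, i \in r -> s * v i = t * u i.
Proof.
move=> uu vu vv.
have uv : \sum_(i <- r) u i * (v i)^* = s * t^*.
  transitivity ((\sum_(i <- r) v i * (u i)^*)^*).
    by rewrite rmorph_sum; apply: eq_bigr => i _; rewrite rmorphM /= conjCK mulrC.
  by rewrite vu rmorphM /= conjCK mulrC.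
have: \sum_(i <- r) `|s * v i - t * u i| ^+ 2 = 0.
  transitivity (s * s^* * \sum_(i <- r) v i * (v i)^*
      - s * t^* * \sum_(i <- r) v i * (u i)^*
      - t * s^* * \sum_(i <- r) u i * (v i)^*
      + t * t^* * \sum_(i <- r) u i * (u i)^*).
    rewrite !mulr_sumr -!sumrB -big_split /=; apply: eq_bigr => i _.
    rewrite normCK !(rmorphB, rmorphM) /=; ring.
  by rewrite uu vu vv uv; ring.
move=> /eqP; rewrite psumr_eq0 => [/allP h i /h|i _]; last exact: exprn_ge0.
by rewrite expf_eq0 /= normr_eq0 subr_eq0 => /eqP.
Qed.

(* sum_p p(x) p(w) = 1 + x^2 w^2 + P(x) P(w) sum_(j < N) (x w)^j. *)
Definition gram_polys (R : nzRingType) N : seq {poly R} :=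
  [:: 1, 'X^2 & [seq ('X^3 - 'X - 1) * 'X^j | j <- index_iota 0 N]].

Lemma big_gram_polys (R : nzRingType) (V : nmodType) N (F : {poly R} -> V) :
  \sum_(p <- gram_polys R N) F p =
  F 1 + (F 'X^2 + \sum_(j < N) F (('X^3 - 'X - 1) * 'X^j)).
Proof. by rewrite /gram_polys 2!big_cons big_map big_mkord. Qed.

(** The geometric sum telescopes the left side to (wx)^N P(w)P(x) - Q(w)Q(x), and x^N P = chi_n + Q.
    Since w need not be a root, the identity can be differentiated in both variables. *)
Lemma gram_identity n (w : algC) :
  (w *: 'X - 1) *
    (\sum_(p <- gram_polys _ n.+1) p.[w] *: p - (1 + w + w ^+ 2) *: (1 + 'X + 'X^2)) =
  (w ^+ n.+1 * (w ^+ 3 - w - 1)) *: chi _ n + (chi _ n).[w] *: (1 - 'X^2 - 'X^3).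
Proof.
apply: poly_ext => x; rewrite big_gram_polys.
rewrite !(horner_chi, hornerE) /= horner_sum.
rewrite (eq_bigr (fun i : 'I_n.+1 =>
  (w ^+ 3 - w - 1) * (x ^+ 3 - x - 1) * (w * x) ^+ i)); last first.
  by move=> i _; rewrite !hornerE exprMn /=; ring.
rewrite -mulr_sumr.
have := subrX1 (w * x) n.+1; set s := \sum_(i < _) _ => e.
rewrite exprMn in e.
set y := w ^+ n.+1 in e *; set z := x ^+ n.+1 in e *.
have {}e : y * z = 1 + (w * x - 1) * s by rewrite -e; ring.
transitivity ((1 + (w * x - 1) * s) * ((w ^+ 3 - w - 1) * (x ^+ 3 - x - 1))
    - (1 - w ^+ 2 - w ^+ 3) * (1 - x ^+ 2 - x ^+ 3)); first by ring.
rewrite -e; ring.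
Qed.

Lemma map_gram_polys (p : {poly algC}) N :
  p \in gram_polys algC N -> map_poly (@Num.conj algC) p = p.
Proof.
rewrite !inE => /or3P[/eqP->|/eqP->|/mapP[j _ ->]];
  by rewrite ?(rmorphM, rmorphB) /= ?rmorph1 ?map_polyXn ?map_polyX.
Qed.

Lemma conj_horner (p : {poly algC}) x :
  map_poly (@Num.conj algC) p = p -> p.[x^*] = p.[x]^*.
Proof. by move=> pC; rewrite -{1}pC horner_map. Qed.

Lemma map_conj_chi n : map_poly (@Num.conj algC) (chi algC n) = chi algC n.
Proof. exact: map_chi. Qed.

Lemma chi_double_root_circle n (a : algC) :
  root (chi algC n) a -> root (chi algC n)^`() a -> a * a^* = 1.
Proof.
move=> ra ra'; apply/eqP/negPn/negP => nab.
have a0 := root_chi_neq0 ra.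
set b := a^* in nab *.
have rb : (chi algC n).[b] = 0.
  by rewrite conj_horner ?map_conj_chi // (rootP ra) rmorph0.
have rb' : (chi algC n)^`().[b] = 0.
  by rewrite conj_horner -?deriv_map ?map_conj_chi // (rootP ra') rmorph0.
pose r := gram_polys algC n.+1.
have [S DS] : {S : {poly algC} | S = 1 + 'X + 'X^2} by exists (1 + 'X + 'X^2).
(* E0 and E1 are the kernel at x = a and its derivative in x there, as
   polynomials in the other variable w. *)
pose E0 := \sum_(p <- r) p.[a] *: p - S.[a] *: S.
pose E1 := \sum_(p <- r) p^`().[a] *: p - S^`().[a] *: S.
pose Q : {poly algC} := 1 - 'X^2 - 'X^3.
(* [D w] is the same kernel as a polynomial in x with w fixed; by symmetry its value and derivative
   at a are [E0] and [E1] at w. *)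
pose D w := \sum_(p <- r) p.[w] *: p - S.[w] *: S.
have DE w : (w *: 'X - 1) * D w =
    (w ^+ n.+1 * (w ^+ 3 - w - 1)) *: chi _ n + (chi _ n).[w] *: Q.
  by rewrite -gram_identity /D DS !hornerE.
have DC w : (D w).[a] = E0.[w].
  rewrite /D /E0 !hornerD !hornerN !hornerZ !horner_sum.
  congr (_ - _); last exact: mulrC.
  by apply: eq_bigr => p _; rewrite !hornerZ mulrC.
have DC' w : (D w)^`().[a] = E1.[w].
  rewrite /D /E1 derivB derivZ !hornerD !hornerN !hornerZ raddf_sum /= !horner_sum.
  congr (_ - _); last exact: mulrC.
  by apply: eq_bigr => p _; rewrite derivZ !hornerZ mulrC.
clearbody D.
have F0 w : (w * a - 1) * E0.[w] = (chi _ n).[w] * Q.[a].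
  have := congr1 (horner^~ a) (DE w).
  rewrite /= [in RHS]hornerD !hornerZ (rootP ra) mulr0 add0r hornerM => <-.
  by rewrite -DC !hornerE.
have F1 w : w * E0.[w] + (w * a - 1) * E1.[w] = (chi _ n).[w] * Q^`().[a].
  have := congr1 (fun p => p^`().[a]) (DE w).
  rewrite /= [in RHS]derivD !derivZ hornerD !hornerZ (rootP ra') mulr0 add0r => <-.
  rewrite -DC -DC' derivM hornerD !hornerM derivB derivZ derivX !hornerE.
  by rewrite derivC !hornerE subr0.
(* Holding for all w, [F0] and [F1] become polynomial identities, which can be differentiated in
   w. *)
have G0 : (a *: 'X - 1) * E0 = Q.[a] *: chi _ n.
  apply: poly_ext => w; rewrite hornerM [RHS]hornerZ [RHS]mulrC -F0 !hornerE.
  by rewrite [w * a]mulrC.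
have G1 : 'X * E0 + (a *: 'X - 1) * E1 = Q^`().[a] *: chi _ n.
  apply: poly_ext => w; rewrite [RHS]hornerZ [RHS]mulrC -F1 !hornerE.
  by rewrite [w * a]mulrC.
(* chi_n has a double zero at b and a b - 1 is nonzero, so [E0] and then [E1] vanish at b together
   with their derivatives. As p(b) is the conjugate of p(a), this yields the three equalities that
   [gram_rank1] asks for. *)
have ab1 : a * b - 1 != 0 by rewrite subr_eq0.
have E0b : E0.[b] = 0.
  by have /eqP := F0 b; rewrite rb mul0r mulf_eq0 mulrC (negPf ab1) => /eqP.
have E1b : E1.[b] = 0.
  have /eqP := F1 b; rewrite rb mul0r E0b mulr0 add0r mulf_eq0 mulrC (negPf ab1).
  by move/eqP.
have E1b' : E1^`().[b] = 0.
  have E0b' : E0^`().[b] = 0.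
    have := congr1 (fun p => p^`().[b]) G0.
    rewrite /= derivZ hornerZ rb' mulr0 derivM hornerD !hornerM E0b mulr0 add0r.
    rewrite !hornerE.
    by move/eqP; rewrite mulf_eq0 (negPf ab1) => /eqP.
  have := congr1 (fun p => p^`().[b]) G1.
  rewrite /= derivZ hornerZ rb' mulr0 derivD !derivM !hornerD !hornerM E0b E0b' E1b.
  rewrite !mulr0 !add0r !hornerE.
  by move/eqP; rewrite mulf_eq0 (negPf ab1) => /eqP.
have SC : map_poly (@Num.conj algC) S = S.
  by rewrite DS !rmorphD /= rmorph1 map_polyX map_polyXn.
have conjd p : map_poly (@Num.conj algC) p = p -> p^`().[b] = p^`().[a]^*.
  by move=> pC; rewrite conj_horner // -deriv_map pC.
have h : forall p, p \in r -> S.[a] * p^`().[a] = S^`().[a] * p.[a].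
  apply: gram_rank1.
  - move/eqP: E0b; rewrite /E0 hornerD hornerN hornerZ horner_sum subr_eq0.
    rewrite (conj_horner _ SC) => /eqP <-.
    by apply: eq_big_seq => p pr; rewrite hornerZ conj_horner // (map_gram_polys pr).
  - move/eqP: E1b; rewrite /E1 hornerD hornerN hornerZ horner_sum subr_eq0.
    rewrite (conj_horner _ SC) => /eqP <-.
    by apply: eq_big_seq => p pr; rewrite hornerZ conj_horner // (map_gram_polys pr).
  - move/eqP: E1b'; rewrite /E1 derivB derivZ raddf_sum /= hornerD hornerN hornerZ.
    rewrite horner_sum subr_eq0 (conjd _ SC) => /eqP <-.
    by apply: eq_big_seq => p pr; rewrite derivZ hornerZ conjd // (map_gram_polys pr).
(* The polynomial 1 has value 1 and derivative 0, which forces S'(a) = 0; then X^2 forces S(a) = 0.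
   The sum of all |p(a)|^2 is therefore 0, although p = 1 contributes 1. *)
have S'0 : S^`().[a] = 0.
  have := h 1; rewrite /r inE eqxx /= => /(_ isT).
  by rewrite -polyC1 derivC !hornerC mulr0 mulr1 => <-.
have S0 : S.[a] = 0.
  have := h 'X^2; rewrite /r !inE eqxx orbT /= => /(_ isT).
  rewrite S'0 mul0r derivXn !hornerE => /eqP.
  by rewrite mulf_eq0 -mulr2n mulrn_eq0 (negPf a0) /= orbF => /eqP.
have := E0b; rewrite /E0 S0 scale0r subr0 horner_sum => /eqP.
rewrite (eq_big_seq (fun p : {poly algC} => `|p.[a]| ^+ 2)); last first.
  by move=> p pr; rewrite hornerZ normCK conj_horner // (map_gram_polys pr).
rewrite psumr_eq0 => [|p _]; last exact: exprn_ge0.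
move=> /allP/(_ 1); rewrite inE eqxx => /(_ isT).
by rewrite /= -polyC1 hornerC normr1 expr1n oner_eq0.
Qed.

(** * No double root on the unit circle *)

Lemma horner_deriv_chi n (x : algC) :
  x * (chi algC n)^`().[x] = 2 * x ^+ 2 + 3 * x ^+ 3
    + x ^+ n.+1 * (n.+4%:R * x ^+ 3 - n.+2%:R * x - n.+1%:R).
Proof.
rewrite /chi !(derivD, derivB, derivN) -polyC1 derivC !derivXn -!scaler_nat.
rewrite !(hornerD, hornerN, hornerZ, hornerXn, hornerC) !add1n !add2n !addSn add0n /=.
rewrite -(addn4 n) -(addn3 n) -(addn2 n) -(addn1 n) !natrD !exprD.
by set m := n%:R; set y := x ^+ n; ring.
Qed.

(* Eliminating a^n between chi_n(a) = 0 and chi_n'(a) = 0. *)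
Lemma double_root_trace_eq n (a w : algC) :
    a * w = 1 -> root (chi algC n) a -> root (chi algC n)^`() a ->
  n.+1%:R * ((a ^+ 3 - a - 1) * (w ^+ 3 - w - 1))
    + (1 - 2 * (a + w) - (a + w) ^+ 2) = 0.
Proof.
move=> aw ra /rootP ra'.
have a0 : a != 0 := root_chi_neq0 ra.
have -> : w = a^-1 by rewrite -[w](mulKf a0) aw mulr1.
have := horner_deriv_chi n a; rewrite ra' mulr0 => /esym.
move: (root_chi ra); set y := a ^+ n.+1 => e1 e2.
(* Multiplying the derivative equation by P(a) makes a^N P(a) = Q(a) usable; the outcome is a^3
   times the claimed expression. *)
have e3 : 0 = (a ^+ 3 - a - 1) * (2 * a ^+ 2 + 3 * a ^+ 3)
    + (y * (a ^+ 3 - a - 1)) * (n.+4%:R * a ^+ 3 - n.+2%:R * a - n.+1%:R).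
  by rewrite -[LHS](mulr0 (a ^+ 3 - a - 1)) -e2; ring.
rewrite e1 in e3.
apply: (mulfI (expf_neq0 3 a0)); rewrite mulr0 [RHS]e3.
rewrite -(addn4 n) -(addn2 n) -(addn1 n) !natrD.
by set m := n%:R; field.
Qed.

(** On the circle w is the conjugate of a, so t = a + w is real in [-2, 2] and h = |P(a)|^2 >= 0.
    The left side of the trace equation thus grows with n, and positivity at n = 7 suffices. *)
Lemma double_root_noncircle n (a : algC) :
    (7 <= n)%N -> root (chi algC n) a -> root (chi algC n)^`() a -> a * a^* != 1.
Proof.
move=> n7 ra ra'; apply/negP => /eqP aa1.
have := double_root_trace_eq aa1 ra ra'.
set w := a^* in aa1 *; set h := _ * (w ^+ 3 - w - 1); set t := a + w => e.
have tR : t \is Num.real by rewrite CrealE /t rmorphD /= /w conjCK addrC.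
have nt : `|t| <= 2.
  have na : `|a| = 1 by apply/eqP; rewrite -sqrp_eq1 // normCK -/w aa1.
  by rewrite (le_trans (ler_normD _ _)) // /w norm_conjC na.
have t2 : 0 <= 2 - t by rewrite subr_ge0 (le_trans (real_ler_norm tR)).
have t2' : 0 <= 2 + t.
  by rewrite -[t]opprK subr_ge0 (le_trans _ nt) // -normrN real_ler_norm ?rpredN.
have h0 : 0 <= h.
  have -> : h = `|a ^+ 3 - a - 1| ^+ 2 by rewrite normCK !(rmorphB, rmorphXn, rmorph1).
  exact: exprn_ge0.
have ht : h = 5 + 4 * t - t ^+ 2 - t ^+ 3.
  have a0 : a != 0 := root_chi_neq0 ra.
  by rewrite /h /t (_ : w = a^-1); [field | rewrite -[w](mulKf a0) aa1 mulr1].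
clearbody h.
have [m Dn] : exists m, n = (m + 7)%N by exists (n - 7)%N; rewrite subnK.
(* With N = 8 + m, this is N h + 1 - 2 t - t^2, where 8 h + 1 - 2 t - t^2
   = 41 + 30 t - 9 t^2 - 8 t^3 is written as a visibly positive sum on [-2, 2]. *)
have : 0 < m%:R * h + 8 * (2 - t) * (t + 31 / 20) ^+ 2
    + 1 / 5 * ((2 - t) * (2 + t)) + 19 / 50 * (2 - t) + 1.
  have s0 : 0 <= (t + 31 / 20) ^+ 2 by rewrite -realEsqr rpredD // rpred_div ?rpred_nat.
  move: (_ ^+ 2) s0 => s s0.
  by rewrite ltr_wpDl ?ltr01 // !addr_ge0 ?mulr_ge0 ?invr_ge0 ?ler0n.
suff -> : m%:R * h + 8 * (2 - t) * (t + 31 / 20) ^+ 2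
    + 1 / 5 * ((2 - t) * (2 + t)) + 19 / 50 * (2 - t) + 1 = 0 by rewrite ltxx.
rewrite -e Dn -addn1 !natrD ht.
by field.
Qed.

Lemma chi_simple_root n (z : algC) :
  (7 <= n)%N -> root (chi algC n) z -> ~~ root (chi algC n)^`() z.
Proof.
move=> n7 rz; apply/negP => rz'; move/eqP: (chi_double_root_circle rz rz').
by rewrite (negPf (double_root_noncircle n7 rz rz')).
Qed.

Lemma mup_chi n (z : algC) :
  (7 <= n)%N -> root (chi algC n) z -> mup z (chi algC n) = 1%N.
Proof.
move=> n7 rz; apply/eqP; rewrite eqn_leq mup_leq ?mup_geq ?chi_neq0 //.
rewrite expr1 dvdp_XsubCl rz andbT; apply: contra (chi_simple_root n7 rz).
case/dvdpP => q ->; rewrite expr2 mulrA derivM derivXsubC mulr1.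
by rewrite rootE hornerD !hornerM !hornerXsubC subrr !mulr0 addr0.
Qed.

(** * Kronecker's theorem *)

(** The inverse Vandermonde matrix recovers the coefficients from the values; the norms of its
    entries give a bound that depends on the points only. *)
Lemma bounded_interpolation (d : nat) (w : 'I_d -> algC) : injective w ->
  exists B : nat, forall p : {poly algC}, (size p <= d)%N ->
    (forall i, `|p.[w i]| <= 1) -> forall j : nat, `|p`_j| <= B%:R.
Proof.
move=> w_inj; pose V := Vandermonde d (\row_i w i).
have Vu : V \in unitmx.
  rewrite unitmxE det_Vandermonde unitfE; apply/prodf_neq0 => i _.
  apply/prodf_neq0 => j ij; rewrite !mxE subr_eq0 (inj_eq w_inj) -val_eqE /=.
  by rewrite gtn_eqF.
pose b := \sum_i \sum_j `|invmx V i j|.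
have b0 : 0 <= b by do 2!apply: sumr_ge0 => ? _.
exists (Num.bound b) => p sp pw j.
have [jd|dj] := ltnP j d; last first.
  by rewrite nth_default ?normr0 ?ler0n // (leq_trans sp).
pose c := \row_(k < d) p`_k.
have cV : c *m V = \row_i p.[w i].
  apply/rowP => i; rewrite !mxE (horner_coef_wide _ sp).
  by apply: eq_bigr => k _; rewrite !mxE.
have -> : p`_j = (\row_i p.[w i] *m invmx V) 0 (Ordinal jd).
  by rewrite -cV mulmxK // mxE.
apply: le_trans (ltW (archi_boundP b0)); rewrite mxE.
apply: le_trans (ler_norm_sum _ _ _) _; apply: ler_sum => i _.
rewrite normrM mxE; apply: le_trans (_ : `|invmx V i (Ordinal jd)| <= _).
  by rewrite ler_piMl.
by rewrite (bigD1 (Ordinal jd)) //= lerDl sumr_ge0.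
Qed.

Lemma int_seq_pigeonhole (d B : nat) (f : nat -> 'I_d -> int) :
  (forall m i, `|f m i| <= B%:Z) -> exists m1 m2, (m1 < m2)%N /\ f m1 =1 f m2.
Proof.
move=> fB; pose M := #|{ffun 'I_d -> 'I_(B + B).+1}|.
(* The shift by B puts every entry in [0, 2B], so neither the absolute value nor [inord] loses
   information. *)
pose g (m : 'I_M.+1) : {ffun 'I_d -> 'I_(B + B).+1} :=
  [ffun i => inord `|f m i + B%:Z|].
have /injectivePn[x [y xy gxy]] : ~~ injectiveb g.
  by apply/negP => /injectiveP /leq_card; rewrite card_ord ltnn.
have fxy : f x =1 f y.
  move=> i.
  have /(congr1 val) /= := congr1 (fun h : {ffun 'I_d -> 'I_(B + B).+1} => h i) gxy.
  rewrite !ffunE !inordK.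
  - by have := fB x i; have := fB y i; lia.
  - by have := fB y i; lia.
  by have := fB x i; lia.
have [lxy|lyx|/val_inj exy] := ltngtP x y.
- by exists x, y.
- by exists y, x; split=> // i; rewrite fxy.
by rewrite exy eqxx in xy.
Qed.

(* Kronecker: the remainders of X^m modulo an integral monic polynomial with
   simple roots in the unit disc are bounded, hence two of them coincide. *)
Lemma kronecker (z : algC) (p : {poly int}) : p \is monic ->
    root (map_poly intr p) z ->
    (forall x : algC, root (map_poly intr p) x -> `|x| <= 1) ->
    (forall x : algC, root (map_poly intr p) x -> ~~ root (map_poly intr p)^`() x) ->
  exists m1 m2, (m1 < m2)%N /\ z ^+ m1 = z ^+ m2.
Proof.
move=> pm rz p1 ps.
set q : {poly algC} := map_poly intr p in rz p1 ps.
have qm : q \is monic by rewrite monic_map.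
have [rs Dq] := closed_field_poly_normal q; rewrite (monicP qm) scale1r in Dq.
have rsq x : (x \in rs) = root q x by rewrite Dq root_prod_XsubC.
have urs : uniq rs.
  rewrite -separable_prod_XsubC -Dq unlock; apply: Pdiv.ClosedField.root_coprimep => x.
  exact: ps.
have sp : size p = (size rs).+1.
  by rewrite -(size_prod_XsubC rs id) -Dq size_map_inj_poly //; apply: intr_inj.
have p0 : p != 0 := monic_neq0 pm.
pose w (i : 'I_(size rs)) := rs`_i.
have w_inj : injective w.
  by move=> i j /eqP; rewrite nth_uniq // => /eqP /val_inj.
have [B HB] := bounded_interpolation w_inj.
pose r m : {poly int} := Pdiv.Ring.rmodp 'X^m p.
(* At a root of p the remainder of X^m takes the value x^m, of modulus at most 1; interpolation then
   bounds its integer coefficients uniformly in m. *)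
have rE m x : root q x -> (map_poly intr (r m)).[x] = x ^+ m :> algC.
  move=> /rootP qx; rewrite -[RHS]hornerXn -(map_polyXn (intr : int -> algC)).
  rewrite [X in _ = (map_poly _ X).[x]](Pdiv.RingMonic.rdivp_eq pm).
  by rewrite rmorphD rmorphM hornerD hornerM /= -/q qx mulr0 add0r.
have rs_r m : (size (r m) <= size rs)%N.
  by rewrite -ltnS -sp Pdiv.Ring.ltn_rmodp.
have [m i|m1 [m2 [lt12 r12]]] := @int_seq_pigeonhole (size rs) B (fun m i => (r m)`_i).
  have := HB (map_poly intr (r m)); rewrite size_map_inj_poly //; last exact: intr_inj.
  move=> /(_ (rs_r m)) /(_ _ i); rewrite coef_map /= -intr_norm pmulrn ler_int.
  apply => {}i.
  have rwi : root q (w i) by rewrite -rsq mem_nth.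
  by rewrite rE // normrX exprn_ile1 // p1.
exists m1, m2; split=> //; rewrite -!rE //; congr (map_poly _ _).[_].
apply/polyP => i; have [li|ge] := ltnP i (size rs); first exact: (r12 (Ordinal li)).
by rewrite !nth_default // (leq_trans (rs_r _)).
Qed.

(** * Roots of unity: conjugates and cyclotomic equations *)

(** Both have the k-th cyclotomic polynomial as minimal polynomial. *)
Lemma root_prim_conj (p : {poly rat}) k (x y : algC) :
    k.-primitive_root x -> k.-primitive_root y ->
  root (map_poly ratr p) x = root (map_poly ratr p) y.
Proof.
move=> px py.
have e : minCpoly x = minCpoly y.
  rewrite (minCpoly_cyclotomic px) (minCpoly_cyclotomic py).
  by rewrite -(Cintr_Cyclotomic px) -(Cintr_Cyclotomic py).
have [mx [Ex _ ->]] := minCpolyP x; have [my [Ey _ ->]] := minCpolyP y.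
by congr (_ %| _); apply: (map_poly_inj (ratr : rat -> algC)); rewrite -Ex -Ey.
Qed.

Lemma root_chi_expr n k a (z : algC) :
    k.-primitive_root z -> coprime a k -> root (chi algC n) z ->
  root (chi algC n) (z ^+ a).
Proof.
move=> pz cak; rewrite -(map_chi (ratr : {rmorphism rat -> algC})).
by rewrite (@root_prim_conj _ k z (z ^+ a)) // prim_root_exp_coprime.
Qed.

Lemma prim_root_half k (z : algC) : k.*2.-primitive_root z -> z ^+ k = -1.
Proof.
move=> pz; have k0 : (0 < k)%N by have := prim_order_gt0 pz; lia.
have: (z ^+ k) ^+ 2 == 1 by rewrite -exprM muln2 (prim_expr_order pz).
rewrite sqrf_eq1 -(prim_order_dvd pz) => /orP[/dvdn_leq|/eqP //].
by move=> /(_ k0); lia.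
Qed.

(** If the order m of z is a proper divisor of k, a prime p dividing k / m gives m | k / p, hence
    z^(k/p) = 1. *)
Lemma prim_rootI (F : fieldType) k (z : F) : (0 < k)%N -> z ^+ k = 1 ->
  (forall p, p \in primes k -> z ^+ (k %/ p) != 1) -> k.-primitive_root z.
Proof.
move=> k0 zk h; have [m pm mk] := prim_order_exists k0 zk.
have [<- //|km] := eqVneq m k.
have km1 : (1 < k %/ m)%N.
  by rewrite ltn_divRL // mul1n ltn_neqAle km dvdn_leq.
have pp := pdiv_prime km1.
have pk : (pdiv (k %/ m) %| k)%N by rewrite (dvdn_trans (pdiv_dvd _)) // dvdn_div.
have := h (pdiv (k %/ m)); rewrite mem_primes pp k0 pk => /(_ isT) /negP[].
rewrite -(prim_order_dvd pm) dvdn_divRL // mulnC -dvdn_divRL //.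
exact: pdiv_dvd.
Qed.

Lemma prim_root_order_inj (F : fieldType) k m (z : F) :
  k.-primitive_root z -> m.-primitive_root z -> k = m.
Proof.
move=> pk pm; apply/eqP; rewrite eqn_dvd (prim_order_dvd pk) (prim_order_dvd pm).
by rewrite (prim_expr_order pk) (prim_expr_order pm) eqxx.
Qed.

Lemma neqN1 : -1 != 1 :> algC.
Proof. by rewrite eq_sym -subr_eq0 opprK (pnatr_eq0 _ 2). Qed.

(** Certificate format: once the cofactor q is supplied, [ring] checks that p = 0 implies x = y. *)
Lemma eq_of_subM (R : comNzRingType) (x y p q : R) : p = 0 -> x - y = p * q -> x = y.
Proof. by move=> -> /eqP; rewrite mul0r subr_eq0 => /eqP. Qed.

Lemma root_of_factor (R : idomainType) (x y : R) : x != 0 -> x * y = 0 -> y = 0.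
Proof. by move=> /negPf x0 /eqP; rewrite mulf_eq0 x0 => /eqP. Qed.

Lemma natC_neq0 n (x : algC) : x = n.+1%:R -> x != 0.
Proof. by move=> ->; rewrite pnatr_eq0. Qed.

(** Pattern for the orders below: Phi_k is what remains of x^k - 1, or of x^(k/2) + 1, once factors
    that would lower the order are removed. Conversely, z^(k/p) = 1 would contradict Phi_k(z) = 0 by
    making a nonzero integer vanish. *)
Lemma prim_root3P (z : algC) : 3.-primitive_root z <-> z ^+ 2 + z + 1 = 0.
Proof.
split=> [pz|e].
  apply: (@root_of_factor _ (z - 1)); first by rewrite subr_eq0 -(prim_order_dvd pz 1).
  by rewrite -[RHS](subrr (z ^+ 3)) {2}(prim_expr_order pz); ring.
apply: prim_rootI => //; first by apply: (eq_of_subM e (q := z - 1)); ring.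
move=> p; rewrite inE => /eqP -> /=; apply: contraPneq e => z1; apply/eqP.
by apply: (@natC_neq0 2); rewrite expr1 in z1; rewrite z1; ring.
Qed.

Lemma prim_root5I (z : algC) :
  z ^+ 4 + z ^+ 3 + z ^+ 2 + z + 1 = 0 -> 5.-primitive_root z.
Proof.
move=> e.
apply: prim_rootI => //; first by apply: (eq_of_subM e (q := z - 1)); ring.
move=> p; rewrite inE => /eqP -> /=; apply: contraPneq e => z1; apply/eqP.
by apply: (@natC_neq0 4); rewrite expr1 in z1; rewrite z1; ring.
Qed.

Lemma prim_root8P (z : algC) : 8.-primitive_root z <-> z ^+ 4 + 1 = 0.
Proof.
split=> [pz|e]; first by rewrite (@prim_root_half 4) ?addNr.
apply: prim_rootI => //; first by apply: (eq_of_subM e (q := z ^+ 4 - 1)); ring.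
move=> p; rewrite inE => /eqP -> /=; apply: contraPneq e => z1; apply/eqP.
by apply: (@natC_neq0 1); rewrite z1; ring.
Qed.

Lemma prim_root12P (z : algC) : 12.-primitive_root z <-> z ^+ 4 - z ^+ 2 + 1 = 0.
Proof.
split=> [pz|e].
  have e6 : z ^+ 6 + 1 = 0 by rewrite (@prim_root_half 6) ?addNr.
  apply: (@root_of_factor _ (z ^+ 2 + 1)); last by rewrite -[RHS]e6; ring.
  apply: contraTneq isT => e2; have := prim_order_dvd pz 4.
  suff -> : z ^+ 4 = 1 by rewrite eqxx.
  by apply: (eq_of_subM e2 (q := z ^+ 2 - 1)); ring.
apply: prim_rootI => //.
  by apply: (eq_of_subM e (q := (z ^+ 2 + 1) * (z ^+ 6 - 1))); ring.
have e6 : z ^+ 6 = -1 by apply: (eq_of_subM e (q := z ^+ 2 + 1)); ring.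
move=> p; rewrite !inE => /orP[]/eqP -> /=; first by rewrite e6 neqN1.
apply/eqP => z4; suff /eqP: 3 = 0 :> algC by rewrite pnatr_eq0.
(* Bezout relation between Phi_12 and x^4 - 1; the same one in x^3 instead of x^2 serves for
   Phi_18. *)
have -> : 3 = (z ^+ 4 - z ^+ 2 + 1) * (z ^+ 2 + 2) - (z ^+ 4 - 1) * (z ^+ 2 + 1).
  by ring.
by rewrite e z4 subrr !mul0r subr0.
Qed.

Lemma prim_root18P (z : algC) : 18.-primitive_root z <-> z ^+ 6 - z ^+ 3 + 1 = 0.
Proof.
split=> [pz|e].
  have e9 : z ^+ 9 + 1 = 0 by rewrite (@prim_root_half 9) ?addNr.
  apply: (@root_of_factor _ (z ^+ 3 + 1)); last by rewrite -[RHS]e9; ring.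
  apply: contraTneq isT => e3; have := prim_order_dvd pz 6.
  suff -> : z ^+ 6 = 1 by rewrite eqxx.
  by apply: (eq_of_subM e3 (q := z ^+ 3 - 1)); ring.
have e9 : z ^+ 9 = -1 by apply: (eq_of_subM e (q := z ^+ 3 + 1)); ring.
apply: prim_rootI => //; first by rewrite (exprM z 9 2) e9 sqrrN expr1n.
move=> p; rewrite !inE => /orP[]/eqP -> /=; first by rewrite e9 neqN1.
apply/eqP => z6; suff /eqP: 3 = 0 :> algC by rewrite pnatr_eq0.
have -> : 3 = (z ^+ 6 - z ^+ 3 + 1) * (z ^+ 3 + 2) - (z ^+ 6 - 1) * (z ^+ 3 + 1).
  by ring.
by rewrite e z6 subrr !mul0r subr0.
Qed.

Lemma prim_root30P (z : algC) : 30.-primitive_root z <->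
  z ^+ 8 + z ^+ 7 - z ^+ 5 - z ^+ 4 - z ^+ 3 + z + 1 = 0.
Proof.
split=> [pz|e].
  have e15 : z ^+ 15 + 1 = 0 by rewrite (@prim_root_half 15) ?addNr.
  have nz i : ~~ (30 %| i)%N -> z ^+ i != 1 by rewrite (prim_order_dvd pz).
  (* x^15 + 1 = (x^5 + 1)(x^2 - x + 1) Phi_30; a zero of the first factor satisfies z^10 = 1, one of
     the second z^6 = 1. *)
  have e10 : z ^+ 10 - z ^+ 5 + 1 = 0.
    apply: (@root_of_factor _ (z ^+ 5 + 1)); last by rewrite -[RHS]e15; ring.
    apply: contraNneq (nz 10%N isT) => e5; apply/eqP.
    by apply: (eq_of_subM e5 (q := z ^+ 5 - 1)); ring.
  apply: (@root_of_factor _ (z ^+ 2 - z + 1)); last by rewrite -[RHS]e10; ring.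
  apply: contraNneq (nz 6%N isT) => e2; apply/eqP.
  by apply: (eq_of_subM e2 (q := (z + 1) * (z ^+ 3 - 1))); ring.
have e15 : z ^+ 15 = -1.
  by apply: (eq_of_subM e (q := 1 - z + z ^+ 2 + z ^+ 5 - z ^+ 6 + z ^+ 7)); ring.
apply: prim_rootI => //; first by rewrite (exprM z 15 2) e15 sqrrN expr1n.
move=> p; rewrite !inE => /or3P[]/eqP -> /=; first by rewrite e15 neqN1.
  apply/eqP => z10; suff /eqP: 3 = 0 :> algC by rewrite pnatr_eq0.
  (* (x^30 - 1) / (x^10 - 1) is a multiple of Phi_30 and equals 3 when z^10 = 1; likewise below with
     x^6 - 1 and 5. *)
  transitivity (z ^+ 10 * z ^+ 10 + z ^+ 10 + 1); first by rewrite z10; ring.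
  apply: (eq_of_subM e (q := 1 - z + z ^+ 2 + z ^+ 5 - z ^+ 6 + z ^+ 7 + z ^+ 10
    - z ^+ 11 + z ^+ 12)); ring.
apply/eqP => z6; suff /eqP: 5 = 0 :> algC by rewrite pnatr_eq0.
transitivity ((z ^+ 6) ^+ 4 + (z ^+ 6) ^+ 3 + (z ^+ 6) ^+ 2 + z ^+ 6 + 1).
  by rewrite z6; ring.
apply: (eq_of_subM e (q := 1 - z + z ^+ 2 + z ^+ 5 + z ^+ 8 + z ^+ 11 + z ^+ 14
  - z ^+ 15 + z ^+ 16)); ring.
Qed.

(* The pairs (k, j) such that chi_j vanishes at the primitive k-th roots of unity. *)
Definition cyclo_residues : seq (nat * nat) :=
  [:: (2, 0); (3, 0); (5, 1); (8, 2); (12, 3); (18, 4); (30, 5)]%N.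


(** * Roots of unity among the roots of chi_n *)

(** For small index chi_j is a product of cyclotomic polynomials: chi_0 = (x^2 - 1) Phi_3, chi_1 =
    x^5 - 1, chi_2 = (x^2 - 1) Phi_8, chi_3 = (x^3 - 1) Phi_12, chi_4 = (x^2 - 1) Phi_18, chi_5 = (x
    - 1) Phi_30. *)
Lemma root_chi_residue k j (z : algC) :
  (k, j) \in cyclo_residues -> k.-primitive_root z -> root (chi algC j) z.
Proof.
rewrite !inE => h pz; apply/rootP; move: h pz; rewrite horner_chi.
do ![case/orP]=> /eqP[-> ->] pz.
- have e : z = -1 by apply: (@prim_root_half 1).
  by rewrite e; ring.
- have [e _] := prim_root3P z; move/e: pz => {}e.
  by apply: subr0_eq; apply: (eq_of_subM e (q := (z + 1) * (z - 1))); ring.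
- have e := prim_expr_order pz.
  by transitivity (z ^+ 5 - 1); [ring | rewrite e subrr].
- have [e _] := prim_root8P z; move/e: pz => {}e.
  by apply: (eq_of_subM e (q := z ^+ 2 - 1)); ring.
- have [e _] := prim_root12P z; move/e: pz => {}e.
  by apply: (eq_of_subM e (q := z ^+ 3 - 1)); ring.
- have [e _] := prim_root18P z; move/e: pz => {}e.
  by apply: (eq_of_subM e (q := z ^+ 2 - 1)); ring.
have [e _] := prim_root30P z; move/e: pz => {}e.
by apply: (eq_of_subM e (q := z - 1)); ring.
Qed.

(** P(z) = 0 would force Q(z) = 0, but (1 - x) Q - x P = 1. *)
Lemma chi_root_factor_neq0 n (z : algC) : root (chi algC n) z -> z ^+ 3 - z - 1 != 0.
Proof.
move=> /root_chi e; apply: contraTneq isT => p0; move: e; rewrite p0 mulr0 => /esym q0.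
suff /eqP: 1 = 0 :> algC by rewrite oner_eq0.
transitivity ((1 - z) * (1 - z ^+ 2 - z ^+ 3) - z * (z ^+ 3 - z - 1)); first by ring.
by rewrite p0 q0 !mulr0 subr0.
Qed.

(** As chi_j(z) = 0, Q(z) can be replaced by z^(j+1) P(z), so chi_n(z) = P(z) (z^(n+1) - z^(j+1))
    with P(z) nonzero. *)
Lemma root_chi_prim n k j (z : algC) :
    (k, j) \in cyclo_residues -> k.-primitive_root z ->
  root (chi algC n) z = (n == j %[mod k])%N.
Proof.
move=> kj pz; have rj := root_chi_residue kj pz.
have p0 := chi_root_factor_neq0 rj; have ej := root_chi rj.
rewrite -(eq_prim_root_expr pz) rootE horner_chi -ej -mulrBl mulf_eq0 (negPf p0) orbF.
by rewrite subr_eq0 !exprS (inj_eq (mulfI (root_chi_neq0 rj))).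
Qed.

Lemma prim_root_chi_order n k (z : algC) :
  k.-primitive_root z -> root (chi algC n) z ->
  k \in [:: 1; 2; 3; 5; 8; 12; 18; 30]%N.
Proof.
move=> pz rz; have k0 := prim_order_gt0 pz.
have ord m : m.-primitive_root z -> m \in [:: 1; 2; 3; 5; 8; 12; 18; 30]%N ->
    k \in [:: 1; 2; 3; 5; 8; 12; 18; 30]%N.
  by move=> /(prim_root_order_inj pz) ->.
have z1 : z - 1 = 0 -> k \in [:: 1; 2; 3; 5; 8; 12; 18; 30]%N.
  move/eqP; rewrite subr_eq0 => /eqP zE; apply: (ord 1%N) => //.
  by apply: prim_rootI; rewrite ?zE ?expr1n.
have zN1 : z + 1 = 0 -> k \in [:: 1; 2; 3; 5; 8; 12; 18; 30]%N.
  move/eqP; rewrite addr_eq0 => /eqP zE; apply: (ord 2%N) => //.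
  apply: prim_rootI; rewrite ?zE ?sqrrN ?expr1n // => p; rewrite inE => /eqP ->.
  exact: neqN1.
have z0 : z = 0 -> k \in [:: 1; 2; 3; 5; 8; 12; 18; 30]%N.
  by move=> zE; have := root_chi_neq0 rz; rewrite zE eqxx.
pose P (x : algC) := x ^+ 3 - x - 1; pose Q (x : algC) := 1 - x ^+ 2 - x ^+ 3.
have eqx x : root (chi algC n) x -> x ^+ n.+1 * P x = Q x by exact: root_chi.
have e := eqx z rz.
have [ko|ke] := boolP (odd k).
  (* For odd k, z^2 is a conjugate. Multiplying its equation by P(z)^2 and using z^N P(z) = Q(z)
     gives Q(z)^2 P(z^2) = P(z)^2 Q(z^2); the difference of the sides is twice the product below. *)
  have := eqx _ (root_chi_expr pz (_ : coprime 2 k) rz).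
  rewrite coprime2n ko -exprM mulnC exprM => /(_ isT) e2.
  have : (z - 1) ^+ 3 * (z + 1) * (z ^+ 2 + z + 1) ^+ 2 *
      (z ^+ 4 + z ^+ 3 + z ^+ 2 + z + 1) = 0.
    apply: (mulfI (_ : 2 != 0 :> algC)); first by rewrite pnatr_eq0.
    rewrite mulr0 -(subrr (P z ^+ 2 * Q (z ^+ 2))) -{1}e2.
    transitivity (Q z ^+ 2 * P (z ^+ 2) - P z ^+ 2 * Q (z ^+ 2)).
      by rewrite /P /Q; ring.
    by rewrite -e; ring.
  move/eqP; rewrite !(expf_eq0, mulf_eq0) /= -!orbA => /or4P[]/eqP //.
    by move/prim_root3P/ord; apply.
  by move/prim_root5I/ord; apply.
have sgnE : z ^+ n.+1 = (-1) ^+ n.+1 * (- z) ^+ n.+1.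
  by rewrite -exprMn mulN1r opprK.
set s : algC := (-1) ^+ n.+1 in sgnE.
have s1 : s = 1 \/ s = -1.
  by rewrite /s -signr_odd; case: odd; [right | left].
have ss : s * s = 1 by case: s1 => ->; rewrite ?mulrNN mulr1.
have zh : z ^+ k./2 = -1 by apply: prim_root_half; rewrite even_halfK.
have [k4|k4] := boolP (odd k./2).
  (* With k/2 odd, k/2 + 2 is prime to k and z^(k/2 + 2) = -z^2. The sign s = (-1)^N gives one
     eliminant for each parity of N. *)
  have := eqx _ (root_chi_expr pz (_ : coprime (k./2 + 2) k) rz).
  rewrite exprD zh mulN1r.
  have -> : coprime (k./2 + 2) k.
    rewrite -[X in coprime _ X](even_halfK ke) -muln2 coprimeMr coprimen2 oddD k4 /=.
    by rewrite /coprime gcdnC gcdnDl -/(coprime _ _) coprimen2 k4.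
  move=> /(_ isT); rewrite -[X in X ^+ n.+1]mulN1r exprMn -/s -exprM mulnC exprM => e2.
  have e3 : s * Q z ^+ 2 * P (- z ^+ 2) - P z ^+ 2 * Q (- z ^+ 2) = 0.
    by rewrite -e2 -e; ring.
  case: s1 => sE; rewrite sE in e3.
    have : (z ^+ 4 - z ^+ 2 + 1) *
        (z ^+ 8 + z ^+ 7 - z ^+ 5 - z ^+ 4 - z ^+ 3 + z + 1) = 0.
      apply: (mulfI (_ : 2 != 0 :> algC)); first by rewrite pnatr_eq0.
      by rewrite mulr0 -oppr0 -[X in _ = - X]e3 /P /Q; ring.
    move/eqP; rewrite mulf_eq0 => /orP[]/eqP.
      by move/prim_root12P/ord; apply.
    by move/prim_root30P/ord; apply.
  have : z * (z - 1) * (z + 1) ^+ 3 * (z ^+ 6 - z ^+ 3 + 1) = 0.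
    apply: (mulfI (_ : 2 != 0 :> algC)); first by rewrite pnatr_eq0.
    by rewrite mulr0 -[RHS]e3 /P /Q; ring.
  move/eqP; rewrite !(expf_eq0, mulf_eq0) /= -!orbA => /or4P[]/eqP //.
  by move/prim_root18P/ord; apply.
(* Now 4 divides k, so k/2 + 1 is prime to k and -z is a conjugate. *)
have := eqx _ (root_chi_expr pz (_ : coprime (k./2 + 1) k) rz).
rewrite exprD zh mulN1r expr1.
have -> : coprime (k./2 + 1) k.
  rewrite -[X in coprime _ X](even_halfK ke) -muln2 coprimeMr coprimen2 oddD.
  rewrite (negPf k4) /=.
  by rewrite /coprime gcdnC gcdnDl gcdn1.
move=> /(_ isT) e2.
have e3 : Q z * P (- z) - s * P z * Q (- z) = 0.
  by rewrite -e2 -e sgnE; ring.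
case: s1 => sE; rewrite sE in e3.
  have : z * (z ^+ 4 - z ^+ 2 + 1) = 0.
    apply: (mulfI (_ : 2 != 0 :> algC)); first by rewrite pnatr_eq0.
    by rewrite mulr0 -[RHS]e3 /P /Q; ring.
  by move/eqP; rewrite mulf_eq0 => /orP[]/eqP // /prim_root12P/ord; apply.
have : (z - 1) * (z + 1) * (z ^+ 4 + 1) = 0.
  apply: (mulfI (_ : 2 != 0 :> algC)); first by rewrite pnatr_eq0.
  by rewrite mulr0 -[RHS]e3 /P /Q; ring.
move/eqP; rewrite !mulf_eq0 -!orbA => /or3P[]/eqP //.
by move/prim_root8P/ord; apply.
Qed.

(** * Minimal polynomials over Q and products of them *)

Lemma minQpoly_dvd x (q : {poly rat}) : root (map_poly ratr q) x = (minQpoly x %| q).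
Proof. exact: (s2valP' (minCpolyP x) q). Qed.

Lemma minQpoly_monic x : minQpoly x \is monic.
Proof. by case: (s2valP (minCpolyP x)). Qed.

Lemma root_minQpoly x : root (map_poly ratr (minQpoly x)) x.
Proof. by rewrite minQpolyE root_minCpoly. Qed.

Lemma minQpoly_irreducible x : irreducible_poly (minQpoly x).
Proof.
split=> [|q q1 /[dup] qp /dvdpP[r Dr]].
  by rewrite -(size_map_poly (ratr : {rmorphism rat -> algC})) minQpolyE size_minCpoly.
rewrite /eqp qp /=; have := root_minQpoly x.
have p0 := monic_neq0 (minQpoly_monic x).
(* A cofactor r vanishing at x would be a multiple of the minimal polynomial, against its degree. *)
rewrite {1}Dr rmorphM rootM !minQpoly_dvd => /orP[|//] /dvdp_leq.
rewrite Dr mulf_eq0 negb_or in p0; case/andP: p0 => r0 q0.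
rewrite r0 Dr size_mul // => /(_ isT) le_r; case/negP: q1.
have := size_poly_gt0 q; have := size_poly_gt0 r; rewrite r0 q0; lia.
Qed.

Lemma minQpoly_conj x y :
  root (map_poly ratr (minQpoly x)) y -> minQpoly x = minQpoly y.
Proof.
rewrite minQpoly_dvd => yx; apply/eqP; rewrite -eqp_monic ?minQpoly_monic // eqp_sym.
have [_ irr] := minQpoly_irreducible x; apply: irr => //.
by have [s _] := minQpoly_irreducible y; rewrite gtn_eqF.
Qed.

Lemma minQpoly1 : minQpoly 1 = 'X - 1.
Proof.
apply/eqP; rewrite -eqp_monic ?minQpoly_monic ?monicXsubC //.
have -> : 'X - 1 = 'X - 1%:P :> {poly rat} by [].
rewrite irredp_XsubC //.
  by have [s _] := minQpoly_irreducible 1; rewrite gtn_eqF.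
by rewrite -minQpoly_dvd polyC1 rmorphB rmorph1 /= map_polyX rootE hornerXsubC subrr.
Qed.

Lemma minQpoly_prim k z : k.-primitive_root z -> minQpoly z = PhiQ k.
Proof.
move=> pz; apply: (map_poly_inj (ratr : {rmorphism rat -> algC})).
rewrite minQpolyE (minCpoly_cyclotomic pz) -(Cintr_Cyclotomic pz) /PhiQ -map_poly_comp.
by apply: eq_map_poly => m /=; rewrite rmorph_int.
Qed.

Lemma root_PhiQ k (z : algC) : (0 < k)%N ->
  root (map_poly ratr (PhiQ k)) z = k.-primitive_root z.
Proof.
move=> k0; have [y py] := C_prim_root_exists k0.
by rewrite -(minQpoly_prim py) minQpolyE (minCpoly_cyclotomic py) root_cyclotomic.
Qed.

Lemma PhiQ_monic k : PhiQ k \is monic.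
Proof. by rewrite monic_map // Cyclotomic_monic. Qed.

Lemma size_prod_PhiQ (s : seq nat) :
  size (\prod_(k <- s) PhiQ k) = (\sum_(k <- s) totient k).+1.
Proof.
elim: s => [|k s IH]; first by rewrite !big_nil size_poly1.
rewrite !big_cons size_Mmonic ?monic_neq0 ?PhiQ_monic //; last first.
  by apply: monic_prod => i _; apply: PhiQ_monic.
by rewrite IH size_map_inj_poly ?size_Cyclotomic ?addnS //; apply: intr_inj.
Qed.

Lemma prod_irreducible_dvdp (F : fieldType) (p : {poly F}) (qs : seq {poly F}) :
    uniq qs -> (forall q, q \in qs -> [/\ q \is monic, irreducible_poly q & q %| p]) ->
  \prod_(q <- qs) q %| p.
Proof.
elim: qs => [|q qs IH] /=; first by rewrite big_nil dvd1p.
move=> /andP[qqs uqs] h; rewrite big_cons.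
have [qm qi qp] := h q (mem_head _ _).
rewrite Gauss_dvdp ?qp ?IH // => [r rqs|]; first by apply: h; rewrite inE rqs orbT.
rewrite big_seq; apply: (big_ind (coprimep q)).
- exact: coprimep1.
- by move=> r s cr cs; rewrite coprimepMr cr cs.
move=> r rqs; have [rm ri _] := h r (mem_behead (s := q :: qs) rqs).
rewrite irreducible_poly_coprime //; apply: contra qqs => qr.
have [s _] := qi; have [_ irr] := ri.
have := irr q; rewrite qr gtn_eqF // => /(_ isT isT); rewrite eqp_monic // => /eqP ->.
exact: rqs.
Qed.

(** Mutual divisibility of monic polynomials: the product divides p because distinct monic
    irreducibles are coprime, and p divides the product because its roots are simple and all
    covered. *)
Lemma factor_minQpoly (p : {poly rat}) (xs : seq algC) :
    p \is monic ->
    (forall z : algC, root (map_poly ratr p) z -> ~~ root (map_poly ratr p)^`() z) ->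
    uniq [seq minQpoly x | x <- xs] ->
    (forall x : algC, x \in xs -> root (map_poly ratr p) x) ->
    (forall z : algC, root (map_poly ratr p) z ->
       exists2 x, x \in xs & root (map_poly ratr (minQpoly x)) z) ->
  p = \prod_(x <- xs) minQpoly x.
Proof.
move=> pm psep uxs xsp pxs.
have mm : \prod_(x <- xs) minQpoly x \is monic.
  by apply: monic_prod => x _; apply: minQpoly_monic.
apply/eqP; rewrite -eqp_monic // /eqp; apply/andP; split; last first.
  rewrite -(big_map minQpoly xpredT id).
  apply: prod_irreducible_dvdp => // _ /mapP[x xx ->].
  by split; rewrite ?minQpoly_monic -?minQpoly_dvd ?xsp //; apply: minQpoly_irreducible.
rewrite -(dvdp_map (ratr : {rmorphism rat -> algC})).
have [rs Dp] := closed_field_poly_normal (map_poly (ratr : rat -> algC) p).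
have pm' : map_poly (ratr : rat -> algC) p \is monic by rewrite monic_map.
rewrite (monicP pm') scale1r in Dp.
rewrite [X in X %| _]Dp; apply: uniq_roots_dvdp.
  apply/allP => z; rewrite -root_prod_XsubC -Dp => /pxs[x xx zx].
  by rewrite rmorph_prod (big_rem x) //= rootM zx.
rewrite uniq_rootsE -separable_prod_XsubC -Dp unlock.
by apply: Pdiv.ClosedField.root_coprimep => z; apply: psep.
Qed.

(** * The set K_n and the factorization of chi_n *)

Lemma KE n : K n = [seq p.1 | p <- cyclo_residues & (n == p.2 %[mod p.1])%N].
Proof.
rewrite /K.
(* By conversion: [2 %| n] computes to [n == 0 %[mod 2]], and likewise for 3. *)
rewrite -[X in filter _ X]/([seq (q.1, n == q.2 %[mod q.1])%N | q <- cyclo_residues]).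
by rewrite filter_map -map_comp.
Qed.

Lemma mem_K n k :
  reflect (exists2 j, (k, j) \in cyclo_residues & (n == j %[mod k])%N) (k \in K n).
Proof.
rewrite KE; apply: (iffP mapP) => [[[k' j]]|[j kj nj]].
  by rewrite mem_filter /= => /andP[nj kj] ->; exists j.
by exists (k, j); rewrite // mem_filter nj.
Qed.

Lemma K_uniq n : uniq (K n).
Proof.
by rewrite KE; apply: (subseq_uniq (map_subseq _ (filter_subseq _ _))).
Qed.

Lemma K_gt1 n k : k \in K n -> (1 < k)%N.
Proof.
by case/mem_K => j; rewrite !inE => h _; move: h; do ![case/orP]; move/eqP => [->].
Qed.

(** A conjugate of z outside the closed unit disc would be lambda, and z would share its minimal
    polynomial. Hence Kronecker applies to the minimal polynomial of z, integral as chi_n is monic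
    over the integers. *)
Lemma root_chi_unity n (lam z : algC) : (7 <= n)%N -> is_lambda n lam ->
    root (chi algC n) z -> minQpoly z != minQpoly lam ->
  exists2 k, k.-primitive_root z & (0 < k)%N.
Proof.
move=> n7 [_ _ lamU] rz zlam.
have zA : z \in Aint.
  apply: (root_monic_Aint rz (chi_monic _ _)).
  rewrite -(map_chi (intr : {rmorphism int -> algC})).
  by apply/polyOverP => i; rewrite coef_map intr_int.
have /floorpP[q Dq] := zA.
have dvq : map_poly intr q %| chi algC n.
  rewrite -Dq -(map_chi (ratr : {rmorphism rat -> algC})) -minQpolyE dvdp_map.
  by rewrite -minQpoly_dvd map_chi.
have rq x : root (map_poly intr q) x -> root (chi algC n) x.
  by rewrite -!dvdp_XsubCl => /dvdp_trans; apply.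
have [||||m1 [m2 [lt12 e12]]] := @kronecker z q.
- have inj : injective (intr : int -> algC) := intr_inj.
  rewrite monicE -(inj_eq inj) -(lead_coef_map_inj inj) // -Dq.
  by rewrite (monicP (minCpoly_monic z)).
- by rewrite -Dq root_minCpoly.
- move=> x rx; rewrite real_leNgt ?normr_real ?real1 //; apply: contra zlam => x1.
  apply/eqP/minQpoly_conj; rewrite minQpolyE Dq.
  by rewrite -(lamU x (rq x rx) x1).
- move=> x rx; have := chi_simple_root n7 (rq x rx); apply: contra => rx'.
  case/dvdpP: dvq => r ->; rewrite derivM rootE hornerD !hornerM.
  by rewrite (rootP rx) (rootP rx') !mulr0 addr0.
have zm : z ^+ (m2 - m1) = 1.
  apply: (mulfI (expf_neq0 m1 (root_chi_neq0 rz))).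
  by rewrite -exprD subnKC ?mulr1 // ltnW.
have [|k pk _] := prim_order_exists _ zm; first by rewrite subn_gt0.
by exists k => //; apply: prim_order_gt0 pk.
Qed.

(** The seven totients add up to 1 + 2 + 4 + 4 + 4 + 6 + 8 = 29. *)
Lemma totient_K n : (\sum_(k <- K n) totient k <= 29)%N.
Proof.
rewrite KE big_map big_filter.
apply: leq_trans (_ : \sum_(p <- cyclo_residues) totient p.1 <= _)%N.
  by rewrite [X in (_ <= X)%N](bigID (fun p => n == p.2 %[mod p.1])%N) /= leq_addr.
by rewrite !big_cons big_nil /=.
Qed.

Theorem theorem3p5 (n : nat) (n_ge7 : (7 <= n)%N) :
  (forall z : algC, root (chi algC n) z -> mup z (chi algC n) = 1%N) /\
  (forall lam : algC, is_lambda n lam ->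
    let psi := minQpoly lam in
    [/\ chi rat n = ('X - 1) * psi * \prod_(k <- K n) PhiQ k,
        irreducible_poly ('X - 1 : {poly rat}),
        irreducible_poly psi,
        (forall k : nat, k \in K n -> irreducible_poly (PhiQ k))
      & (n%:Z - 26 <= (size psi).-1%:Z <= n%:Z + 3)]).
Proof.
split=> [z|lam Hlam psi]; first exact: mup_chi.
have [rlam lam1 _] := Hlam.
(* Writing the order as k.-1.+1 makes [zeta] total; for k > 0 it is a primitive k-th root of
   unity. *)
pose zeta (k : nat) : algC := sval (C_prim_root_exists (ltn0Sn k.-1)).
have zetaP k : k \in K n -> k.-primitive_root (zeta k).
  move=> /K_gt1 k1; rewrite /zeta; case: C_prim_root_exists => z /=.
  by rewrite prednK // ltnW.
have psiN k : (0 < k)%N -> ~~ k.-primitive_root lam.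
  move=> k0; apply: contraTN lam1 => /prim_expr_order lamk; apply/negP => lam1.
  by have := expr_gt1 k0 (ltW (lt_trans ltr01 lam1)); rewrite lamk ltxx lam1.
have E : chi rat n = ('X - 1) * psi * \prod_(k <- K n) PhiQ k.
  (* One representative root for each expected irreducible factor. *)
  rewrite [LHS](@factor_minQpoly _ [:: 1, lam & [seq zeta k | k <- K n]]).
  - rewrite !big_cons minQpoly1 mulrA big_map; congr (_ * _).
    by apply: eq_big_seq => k kK; apply: minQpoly_prim (zetaP k kK).
  - exact: chi_monic.
  - by move=> z; rewrite map_chi; apply: chi_simple_root.
  (* Distinctness: lambda > 1 is neither 1 nor a root of unity, and roots of unity of different
     orders are not conjugate. *)
  - have Ephi : {in K n, minQpoly \o zeta =1 PhiQ}.
      by move=> k kK; apply: minQpoly_prim (zetaP k kK).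
    rewrite /= -map_comp ((eq_in_map _ _ _).1 Ephi).
    rewrite !inE negb_or; apply/and3P; split.
    + apply/andP; split.
        apply: contraTneq lam1 => e; have := root_minQpoly lam.
        rewrite -e minQpoly1 rmorphB rmorph1 /= map_polyX root_XsubC => /eqP ->.
        by rewrite ltxx.
      apply/mapP => -[k kK e]; have := root_minQpoly 1; rewrite e.
      have k1 := K_gt1 kK; rewrite root_PhiQ 1?ltnW // => /prim_order_dvd /(_ 1%N).
      by rewrite expr1 eqxx dvdn1 gtn_eqF.
    + apply/mapP => -[k kK e]; have := root_minQpoly lam; rewrite e.
      by have k1 := K_gt1 kK; rewrite root_PhiQ 1?ltnW // (negPf (psiN k (ltnW k1))).
    rewrite map_inj_in_uniq ?K_uniq // => k m kK mK e.
    apply: (prim_root_order_inj (zetaP k kK)).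
    by rewrite -root_PhiQ ?(ltnW (K_gt1 mK)) // -e root_PhiQ ?(ltnW (K_gt1 kK)) ?zetaP.
  - move=> x; rewrite map_chi !inE => /or3P[/eqP->|/eqP->//|/mapP[k kK ->]].
      by apply/rootP; rewrite horner_chi !expr1n; ring.
    have /mem_K[j kj nj] := kK.
    by rewrite (root_chi_prim n kj (zetaP k kK)).
  move=> z; rewrite map_chi => rz.
  have [e|ne] := eqVneq (minQpoly z) psi.
    by exists lam; rewrite ?inE ?eqxx ?orbT // -/psi -e root_minQpoly.
  have [k pk k0] := root_chi_unity n_ge7 Hlam rz ne.
  have kin := prim_root_chi_order pk rz.
  have [k1|k1] := eqVneq k 1%N.
    exists 1; rewrite ?mem_head //.
    by have := prim_expr_order pk; rewrite k1 expr1 => ->; apply: root_minQpoly.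
  have [j kj] : exists j, (k, j) \in cyclo_residues.
    move: kin; rewrite inE (negPf k1) /= -[X in _ \in X]/(map fst cyclo_residues).
    by case/mapP => -[k' j] kj ->; exists j.
  have kK : k \in K n by apply/mem_K; exists j => //; rewrite -(root_chi_prim n kj pk).
  exists (zeta k); first by rewrite !inE map_f ?orbT.
  by rewrite (minQpoly_prim (zetaP k kK)) root_PhiQ.
split=> //.
- by rewrite -minQpoly1; apply: minQpoly_irreducible.
- exact: minQpoly_irreducible.
- by move=> k kK; rewrite -(minQpoly_prim (zetaP k kK)); apply: minQpoly_irreducible.
(* Degrees: n + 4 = 1 + deg psi + the sum of the totients, which lies between 0 and 29. *)
have := totient_K n; have := congr1 (fun p : {poly rat} => (size p).-1) E.
have prodM : \prod_(k <- K n) PhiQ k \is monic.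
  by apply: monic_prod => k _; apply: PhiQ_monic.
have X1 : 'X - 1 = 'X - 1%:P :> {poly rat} by [].
rewrite size_Mmonic ?monic_neq0 ?monicMl ?minQpoly_monic ?X1 ?monicXsubC //.
rewrite size_Mmonic ?monic_neq0 ?minQpoly_monic ?monicXsubC // size_XsubC.
rewrite size_chi size_prod_PhiQ.
have [psi_gt1 _] := minQpoly_irreducible lam; rewrite -/psi in psi_gt1 *; lia.
Qed.
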